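(* The vector fields defined by the maps $\Psi_k(g)=g^k-g^{-k}$ for $k\ge1$ are a basis for $\mathfrak X_2$ as a vector space over $\mathbf C$.
   Context: $\mathfrak X_2=\mathfrak X(\mathrm{SL}(2,\mathbf C))^{\mathrm{Ad}\,\mathrm{SL}(2,\mathbf C)}$ is the space of regular algebraic vector fields on $\mathrm{SL}(2,\mathbf C)$ invariant under conjugation. The vector field defined by a regular conjugation-equivariant map $\Phi:\mathrm{SL}(2,\mathbf C)\to\mathfrak{sl}(2,\mathbf C)$ is $f\mapsto\big(g\mapsto\frac{d}{dt}f(g+tg\Phi(g))|_{t=0}\big)$ for $f\in\mathbf C[\mathrm{SL}(2,\mathbf C)]$ (extended to a neighborhood of $\mathrm{SL}(2,\mathbf C)$ in the $2\times2$ matrices). *)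

(* Defs.v *)
From HB Require Import structures.
From mathcomp Require Import all_boot all_order all_algebra.
From mathcomp Require Import all_classical all_reals all_analysis.
From mathcomp Require Import complex.
From mathcomp Require Import ring.
From mathcomp Require mpoly.
Import -(notations) mpoly.

Set Implicit Arguments.
Unset Strict Implicit.
Unset Printing Implicit Defensive.

Import Order.TTheory GRing.Theory Num.Theory.
Import numFieldNormedType.Exports.

Local Open Scope classical_set_scope.
Local Open Scope ring_scope.

(* Everything is stated over a numFieldType K (hence an infinite field of
   characteristic 0, so that regular functions may be identified with the
   functions they induce on K-points); the case of interest is K = R[i]. *)

Record SL2 (K : numFieldType) :=
  MkSL2 { SL2_val :> 'M[K]_2; SL2_valP : \det SL2_val == 1 }.

HB.instance Definition _ (K : numFieldType) := [isSub for @SL2_val K].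
HB.instance Definition _ (K : numFieldType) := [Choice of SL2 K by <:].

Section Group.
Variable K : numFieldType.
Implicit Types g h : SL2 K.

Lemma SL2_det g : \det g = 1. Proof. exact/eqP/SL2_valP. Qed.

Lemma SL2_unit g : (g : 'M[K]_2) \in unitmx.
Proof. by rewrite unitmxE SL2_det unitr1. Qed.

Lemma SL2_inv g : invmx g = \adj g.
Proof. by rewrite /invmx SL2_unit SL2_det invr1 scale1r. Qed.

Fact SL2_one_subproof : \det (1 : 'M[K]_2) == 1. Proof. by rewrite det1. Qed.

Definition SL2_one : SL2 K := MkSL2 SL2_one_subproof.

Fact SL2_conj_subproof h g : \det (h *m g *m invmx h) == 1.
Proof. by rewrite !det_mulmx det_inv !SL2_det mulr1 invr1 mulr1. Qed.

Definition SL2_conj h g : SL2 K := MkSL2 (SL2_conj_subproof h g).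

End Group.

HB.instance Definition _ (K : numFieldType) :=
  isPointed.Build (SL2 K) (SL2_one K).

Section CoordRing.
Variable K : numFieldType.
Notation P := (mpoly (2 * 2) K).

(* Value of a polynomial in the four matrix entries. *)
Definition mxeval (p : P) (A : 'M[K]_2) : K :=
  meval (fun i => mxvec A 0 i) p.

Definition regular_fun : {pred (SL2 K -> K)} :=
  fun f => `[< exists p : P, forall g, f g = mxeval p g >].

Lemma regularP (f : SL2 K -> K) :
  reflect (exists p : P, forall g, f g = mxeval p g) (f \in regular_fun).
Proof. exact: asboolP. Qed.

Lemma mxevalE p A : mxeval p A = meval (fun i => mxvec A 0 i) p.
Proof. by []. Qed.

Lemma regular_cst c : (fun _ : SL2 K => c) \in regular_fun.
Proof. by apply/regularP; exists (mpolyC _ c) => g; rewrite mxevalE mevalC. Qed.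

Lemma regular_entry i j : (fun g : SL2 K => g i j) \in regular_fun.
Proof.
apply/regularP; exists (mpolyX _ (mnm1 (mxvec_index i j))) => g.
by rewrite mxevalE mevalXU mxvecE.
Qed.

Fact regular_subring : subring_closed regular_fun.
Proof.
split; first exact: regular_cst.
- move=> f g /regularP[p pE] /regularP[q qE]; apply/regularP.
  exists (p - q) => x; rewrite mxevalE mevalB -!mxevalE -pE -qE; exact: erefl.
- move=> f g /regularP[p pE] /regularP[q qE]; apply/regularP.
  exists (p * q) => x; rewrite mxevalE mevalM -!mxevalE -pE -qE; exact: erefl.
Qed.

HB.instance Definition _ := GRing.isSubringClosed.Build _ regular_fun regular_subring.

Fact regular_scale : scaler_closed regular_fun.
Proof.
move=> c f /regularP[p pE]; apply/regularP.
exists (c *: p) => x; rewrite mxevalE mevalZ -mxevalE -pE; exact: erefl.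
Qed.

HB.instance Definition _ := GRing.isScaleClosed.Build K _ regular_fun regular_scale.

Record coordRing :=
  MkCoordRing { coord_fun :> SL2 K -> K; coord_funP : coord_fun \in regular_fun }.

HB.instance Definition _ := [isSub for coord_fun].
HB.instance Definition _ := [Choice of coordRing by <:].
HB.instance Definition _ := [SubChoice_isSubComNzRing of coordRing by <:].
HB.instance Definition _ := [SubZmodule_isSubLmodule of coordRing by <:].

Lemma coordRing_ext (f1 f2 : coordRing) : (forall g, f1 g = f2 g) -> f1 = f2.
Proof. by move=> eqf; apply/val_inj/funext. Qed.

(* A polynomial extending f to the whole space of 2 x 2 matrices; the choice is
   immaterial for vector fields, see vfield_extension below. *)
Definition extension (f : coordRing) : P := sval (cid (regularP _ (coord_funP f))).

Lemma extensionP (f : coordRing) g : f g = mxeval (extension f) g.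
Proof. by rewrite /extension; case: cid. Qed.

Fact mxeval_linsubst (L : 'M[K]_2 -> 'M[K]_2) (p : P) : linear L ->
  exists q : P, forall A, mxeval q A = mxeval p (L A).
Proof.
move=> linL.
pose F k : P := \sum_i mxvec (L (vec_mx (delta_mx 0 i))) 0 k *: mpolyX _ (mnm1 i).
exists (comp_mpoly [tuple F k | k < 2 * 2] p) => A.
rewrite /mxeval comp_mpoly_meval; apply: meval_eq => k.
rewrite tnth_mktuple /F raddf_sum /=.
pose LL := GRing.isLinear.Build _ _ _ _ L linL.
pose L' : {linear 'M[K]_2 -> 'M[K]_2} := HB.pack L LL.
rewrite -[in RHS](mxvecK A) [mxvec A in RHS]row_sum_delta.
rewrite -[L _]/(L' _) !linear_sum summxE; apply: eq_bigr => i _.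
by rewrite !linearZ /= mxE mevalXU mulrC.
Qed.

Fact pullback_subproof h (f : coordRing) :
  (fun g => f (SL2_conj h g)) \in regular_fun.
Proof.
have [p pE] := regularP _ (coord_funP f).
have linL : linear (fun A => h *m A *m invmx h).
  by move=> c A B; rewrite mulmxDr mulmxDl -scalemxAr -scalemxAl.
have [q qE] := mxeval_linsubst p linL.
by apply/regularP; exists q => g; rewrite qE pE.
Qed.

Definition pullback_conj h (f : coordRing) : coordRing :=
  MkCoordRing (pullback_subproof h f).

(* Regular algebraic vector fields are the K-linear derivations of K[SL2]. *)
Definition is_derivation (D : coordRing -> coordRing) : Prop :=
  linear D /\ forall f1 f2, D (f1 * f2) = D f1 * f2 + f1 * D f2.

Definition Ad_invariant (D : coordRing -> coordRing) : Prop :=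
  forall h f, D (pullback_conj h f) = pullback_conj h (D f).

Definition invariant_vfield : {pred (coordRing -> coordRing)} :=
  fun D => `[< is_derivation D /\ Ad_invariant D >].

Lemma invariant_vfieldP (D : coordRing -> coordRing) :
  reflect (is_derivation D /\ Ad_invariant D) (D \in invariant_vfield).
Proof. exact: asboolP. Qed.

Fact invariant_vfield_submod : submod_closed invariant_vfield.
Proof.
split.
  apply/invariant_vfieldP; split; first split.
  - by move=> c f1 f2; rewrite scaler0 addr0.
  - by move=> f1 f2; rewrite mul0r mulr0 addr0.
  - by move=> h f; apply: coordRing_ext.
move=> c D1 D2 /invariant_vfieldP[[l1 m1] i1] /invariant_vfieldP[[l2 m2] i2].
apply/invariant_vfieldP; split; first split.
- move=> a f1 f2; rewrite -[LHS]/(c *: D1 _ + D2 _) l1 l2.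
  rewrite -[RHS]/(a *: (c *: D1 f1 + D2 f1) + (c *: D1 f2 + D2 f2)).
  by rewrite !scalerDr !scalerA [a * c]mulrC addrACA.
- move=> f1 f2; rewrite -[LHS]/(c *: D1 _ + D2 _) m1 m2.
  rewrite -[RHS]/((c *: D1 f1 + D2 f1) * f2 + f1 * (c *: D1 f2 + D2 f2)).
  apply: coordRing_ext => g.
  rewrite -[LHS]/(c * ((D1 f1) g * f2 g + f1 g * (D1 f2) g) +
     ((D2 f1) g * f2 g + f1 g * (D2 f2) g)).
  rewrite -[RHS]/((c * (D1 f1) g + (D2 f1) g) * f2 g +
     f1 g * (c * (D1 f2) g + (D2 f2) g)).
  by ring.
- move=> h f; rewrite -[LHS]/(c *: D1 _ + D2 _) i1 i2.
  exact: coordRing_ext.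
Qed.

HB.instance Definition _ :=
  GRing.isSubmodClosed.Build K _ invariant_vfield invariant_vfield_submod.

Record X2 :=
  MkX2 { X2_fun :> coordRing -> coordRing; X2_funP : X2_fun \in invariant_vfield }.

HB.instance Definition _ := [isSub for X2_fun].
HB.instance Definition _ := [Choice of X2 by <:].
HB.instance Definition _ := [SubChoice_isSubZmodule of X2 by <:].
HB.instance Definition _ := [SubZmodule_isSubLmodule of X2 by <:].

(* Regular maps from SL2 to sl2 equivariant under conjugation. *)
Record equivMap := MkEquivMap {
  equiv_map :> SL2 K -> 'M[K]_2;
  equiv_map_tr : forall g, \tr (equiv_map g) = 0;
  equiv_map_regular : forall i j, (fun g => equiv_map g i j) \in regular_fun;
  equiv_map_conj : forall h g,
    equiv_map (SL2_conj h g) = h *m equiv_map g *m invmx h }.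

(* Differential of p at the matrix A in the direction U. *)
Definition dmx (p : P) (A U : 'M[K]_2) : K :=
  \sum_k mxeval (mderiv k p) A * mxvec U 0 k.

Fact is_derive_mxeval (p : P) (u : K -> 'M[K]_2) (U : 'M[K]_2) :
  (forall i j, is_derive (0 : K) 1 (fun t => u t i j) (U i j)) ->
  is_derive (0 : K) 1 (fun t => mxeval p (u t)) (dmx p (u 0) U).
Proof.
move=> du.
have du' k : is_derive (0 : K) 1 (fun t => mxvec (u t) 0 k) (mxvec U 0 k).
  case/mxvec_indexP: k => i j; rewrite mxvecE.
  by rewrite (_ : (fun t => _) = fun t => u t i j) //; apply/funext => t; rewrite mxvecE.
pose Q (q : P) := is_derive (0 : K) 1 (fun t => mxeval q (u t)) (dmx q (u 0) U).
have QM q1 q2 : Q q1 -> Q q2 -> Q (q1 * q2).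
  rewrite /Q => d1 d2.
  rewrite (_ : (fun t => _) = (fun t => mxeval q1 (u t)) * (fun t => mxeval q2 (u t))); last first.
    by apply/funext => t; rewrite /mxeval mevalM.
  apply: is_derive_eq; rewrite /dmx !scaler_sumr -big_split; apply: eq_bigr => k _ /=.
  by rewrite mderivM /mxeval mevalD !mevalM /GRing.scale /=; ring.
have QC c : Q (mpolyC _ c).
  rewrite /Q (_ : (fun t => _) = cst c); last by apply/funext => t; rewrite /mxeval mevalC.
  apply: is_derive_eq; rewrite /dmx big1 // => k _.
  by rewrite mderivC /mxeval meval0 mul0r.
have QX k : Q (mpolyX _ (mnm1 k)).
  rewrite /Q (_ : (fun t => _) = fun t => mxvec (u t) 0 k); last first.
    by apply/funext => t; rewrite /mxeval mevalXU.
  apply: is_derive_eq; rewrite /dmx (bigD1 k) //= big1 ?addr0 => [|i ik].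
    have mm0 : mnm_sub (mnm1 k) (mnm1 k) = @mnm0 (2 * 2).
      by rewrite -[X in mnm_sub X _]add0m addmK.
    by rewrite mderivX mnmE eqxx mm0 mpolyX0 /mxeval mevalZ meval1 mulr1 mul1r.
  by rewrite mderivX mnm1E eq_sym (negbTE ik) scale0r /mxeval meval0 mul0r.
have QD q1 q2 : Q q1 -> Q q2 -> Q (q1 + q2).
  rewrite /Q => d1 d2.
  rewrite (_ : (fun t => _) = (fun t => mxeval q1 (u t)) + (fun t => mxeval q2 (u t))); last first.
    by apply/funext => t; rewrite /mxeval mevalD.
  apply: is_derive_eq; rewrite /dmx -big_split; apply: eq_bigr => k _ /=.
  by rewrite mderivD /mxeval mevalD mulrDl.
rewrite -/(Q p); elim/mpolyind: p => [|c m p _ _ IH]; first exact: (QC 0).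
apply: (QD _ _ _ IH); rewrite -mul_mpolyC; apply: (QM _ _ (QC c)).
rewrite mpolyXE_id; apply: big_ind; [exact: (QC 1)|exact: QM|move=> i _].
by elim: (m i) => [|n IHn]; [exact: (QC 1)|rewrite exprS; exact: (QM _ _ (QX i) IHn)].
Qed.

Lemma tangent_line p (A U : 'M[K]_2) :
  is_derive (0 : K) 1 (fun t => mxeval p (A + t *: U)) (dmx p A U).
Proof.
rewrite -{2}[A]addr0 -[X in A + X](scale0r U).
apply: (@is_derive_mxeval p (fun t => A + t *: U)) => i j.
rewrite (_ : (fun t => _) = cst (A i j) + U i j \*: (@id K)); last first.
  by apply/funext => t; rewrite !mxE /= mulrC.
by apply: is_derive_eq; rewrite add0r /GRing.scale /= mulr1.
Qed.

Lemma dmxD p A U V : dmx p A (U + V) = dmx p A U + dmx p A V.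
Proof.
by rewrite /dmx -big_split; apply: eq_bigr => k _; rewrite raddfD mxE mulrDr.
Qed.

Lemma dmxZ p A c U : dmx p A (c *: U) = c * dmx p A U.
Proof.
rewrite /dmx mulr_sumr; apply: eq_bigr => k _.
by rewrite linearZ mxE mulrCA.
Qed.

Lemma det2 (A : 'M[K]_2) : \det A = A 0 0 * A 1 1 - A 0 1 * A 1 0.
Proof.
rewrite (expand_det_row _ 0) !big_ord_recl big_ord0 addr0 /cofactor !det_mx11 !mxE /=.
rewrite expr0 expr1 mul1r mulN1r mulrN.
by congr (A _ _ * A _ _ - A _ _ * A _ _); apply: val_inj.
Qed.

Lemma mxtrace2 (A : 'M[K]_2) : \tr A = A 0 0 + A 1 1.
Proof. by rewrite /mxtrace !big_ord_recl big_ord0 addr0; congr (_ + A _ _); exact: val_inj. Qed.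

Fact dmx_nilp p (g : SL2 K) (N : 'M[K]_2) :
  (forall g : SL2 K, mxeval p g = 0) -> \tr N = 0 -> \det N = 0 ->
  dmx p g (g *m N) = 0.
Proof.
move=> p0 trN detN.
have gN t : \det ((g : 'M[K]_2) + t *: (g *m N)) == 1.
  rewrite scalemxAr -[X in \det (X + _)]mulmx1 -mulmxDr det_mulmx SL2_det mul1r.
  move: trN detN; rewrite mxtrace2 !det2 !mxE /= => trN detN.
  apply/eqP; transitivity (1 + t * (N 0 0 + N 1 1) +
    t ^+ 2 * (N 0 0 * N 1 1 - N 0 1 * N 1 0)); first by ring.
  by rewrite trN detN !mulr0 !addr0.
have := tangent_line p g (g *m N).
rewrite (_ : (fun t => _) = cst 0); last first.
  by apply/funext => t; exact: (p0 (MkSL2 (gN t))).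
by move=> /@derive_val <-; rewrite derive_cst.
Qed.

Fact dmx_vanish p (g : SL2 K) (X : 'M[K]_2) :
  (forall g : SL2 K, mxeval p g = 0) -> \tr X = 0 -> dmx p g (g *m X) = 0.
Proof.
move=> p0 trX.
pose N1 : 'M[K]_2 := \matrix_(i, j) if j == 0 then 1 else - 1.
pose N2 : 'M[K]_2 := delta_mx 0 1.
pose N3 : 'M[K]_2 := delta_mx 1 0.
have -> : X = X 0 0 *: N1 + (X 0 1 + X 0 0) *: N2 + (X 1 0 - X 0 0) *: N3.
  have X11 : X 1 1 = - X 0 0.
    by apply/eqP; rewrite -addr_eq0 addrC -mxtrace2 trX.
  have i2 (i : 'I_2) : i = 0 \/ i = 1.
    by case: i => [[|[|//]] hi]; [left|right]; exact: val_inj.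
  apply/matrixP => i j.
  by case: (i2 i) => ->; case: (i2 j) => ->; rewrite !mxE /= ?X11; ring.
rewrite !mulmxDr !dmxD -!scalemxAr !dmxZ.
by rewrite !(dmx_nilp _ p0) ?mxtrace2 ?det2 ?mxE /=; ring.
Qed.

Variable Phi : equivMap.

Definition flow_derivative (p : P) (g : SL2 K) : K :=
  derive1 (fun t : K => mxeval p ((g : 'M[K]_2) + t *: (g *m Phi g))) 0.

Lemma flow_derivativeE p g : flow_derivative p g = dmx p g (g *m Phi g).
Proof.
rewrite /flow_derivative derive1E.
exact: (@derive_val _ _ _ _ _ _ _ (tangent_line p g (g *m Phi g))).
Qed.

Lemma flow_derivative_ext p q :
  (forall g : SL2 K, mxeval p g = mxeval q g) ->
  forall g, flow_derivative p g = flow_derivative q g.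
Proof.
move=> pq g; apply/eqP; rewrite -subr_eq0 !flow_derivativeE; apply/eqP.
rewrite -(@dmx_vanish (p - q) g (Phi g)) ?equiv_map_tr //.
  rewrite /dmx -sumrB; apply: eq_bigr => k _.
  by rewrite mderivB /mxeval mevalB mulrBl.
by move=> h; rewrite /mxeval mevalB -!/(mxeval _ _) pq subrr.
Qed.

Fact vfield_subproof (f : coordRing) : flow_derivative (extension f) \in regular_fun.
Proof.
rewrite (_ : flow_derivative _ =
  \sum_k (fun g : SL2 K => mxeval (mderiv k (extension f)) g) *
         (fun g : SL2 K => mxvec (g *m Phi g) 0 k)); last first.
  apply/funext => g; rewrite flow_derivativeE /dmx fct_sumE.
  exact: eq_bigr.
apply: rpred_sum => k _; apply: rpredM.
  by apply/regularP; eexists => g; exact: erefl.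
case/mxvec_indexP: k => i j.
rewrite (_ : (fun g => _) =
  \sum_l (fun g : SL2 K => g i l) * (fun g : SL2 K => Phi g l j)).
  by apply: rpred_sum => l _; apply: rpredM; [exact: regular_entry|exact: equiv_map_regular].
by apply/funext => g; rewrite mxvecE mxE fct_sumE; exact: eq_bigr.
Qed.

(* The vector field defined by Phi: the value at g of its action on f is the
   derivative at t = 0 of f (g + t g Phi(g)), f being extended to matrices. *)
Definition vfield_fun (f : coordRing) : coordRing := MkCoordRing (vfield_subproof f).

Lemma vfield_extension (f : coordRing) (p : P) :
  (forall g, f g = mxeval p g) ->
  forall g, vfield_fun f g =
            derive1 (fun t : K => mxeval p ((g : 'M[K]_2) + t *: (g *m Phi g))) 0.
Proof.
by move=> fp g; apply: flow_derivative_ext => h; rewrite -extensionP fp.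
Qed.

Fact vfield_invariant : vfield_fun \in invariant_vfield.
Proof.
have vE (f : coordRing) p (g : SL2 K) :
    (forall g : SL2 K, f g = mxeval p g) ->
    vfield_fun f g = dmx p g (g *m Phi g).
  by move=> fp; rewrite (vfield_extension fp) -flow_derivativeE.
apply/invariant_vfieldP; split; first split.
- move=> c f1 f2; apply: coordRing_ext => g.
  rewrite -[RHS]/(c * vfield_fun f1 g + vfield_fun f2 g).
  rewrite (vE _ (c *: extension f1 + extension f2)); last first.
    move=> h; rewrite -[LHS]/(c * f1 h + f2 h) !extensionP.
    by rewrite /mxeval mevalD mevalZ.
  rewrite !(vE _ _ _ (extensionP _)) /dmx mulr_sumr -big_split; apply: eq_bigr => k _ /=.
  by rewrite mderivD mderivZ /mxeval mevalD mevalZ mulrDl mulrA.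
- move=> f1 f2; apply: coordRing_ext => g.
  rewrite -[RHS]/(vfield_fun f1 g * f2 g + f1 g * vfield_fun f2 g).
  rewrite (vE _ (extension f1 * extension f2)); last first.
    move=> h; rewrite -[LHS]/(f1 h * f2 h) !extensionP.
    by rewrite /mxeval mevalM.
  rewrite !(vE _ _ _ (extensionP _)) !extensionP /dmx mulr_suml mulr_sumr -big_split.
  by apply: eq_bigr => k _ /=; rewrite mderivM /mxeval mevalD !mevalM; ring.
move=> h f; apply: coordRing_ext => g.
rewrite -[RHS]/(vfield_fun f (SL2_conj h g)).
have linL : linear (fun A => h *m A *m invmx h).
  by move=> c A B; rewrite mulmxDr mulmxDl -scalemxAr -scalemxAl.
have [q qE] := mxeval_linsubst (extension f) linL.
rewrite (@vfield_extension _ q); last first.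
  by move=> k; rewrite -[LHS]/(f (SL2_conj h k)) extensionP qE.
rewrite (vfield_extension (extensionP f)); congr (derive1 _ 0).
apply/funext => t; rewrite qE equiv_map_conj mulmxDr mulmxDl -scalemxAr -scalemxAl.
congr (mxeval _ (_ + _ *: _)); rewrite /= !mulmxA; congr (_ *m _).
by rewrite mulmxKV ?SL2_unit.
Qed.

Definition vfield : X2 := MkX2 vfield_invariant.

End CoordRing.

Section Psi.
Variable K : numFieldType.

(* The ring inverse ^- k on matrices is the matrix inverse, as det g = 1. *)
Definition Psi_fun (k : nat) (g : SL2 K) : 'M[K]_2 :=
  (g : 'M[K]_2) ^+ k - (g : 'M[K]_2) ^- k.

Lemma adj2 (A : 'M[K]_2) : \adj A = (\tr A)%:M - A.
Proof.
have i2 (i : 'I_2) : i = 0 \/ i = 1.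
  by case: i => [[|[|//]] hi]; [left|right]; exact: val_inj.
apply/matrixP => i j; rewrite !mxE /cofactor mxtrace2 det_mx11 !mxE.
have l0 : lift (0 : 'I_2) 0 = 1 by exact: val_inj.
have l1 : lift (1 : 'I_2) 0 = 0 by exact: val_inj.
by case: (i2 i) => ->; case: (i2 j) => ->; rewrite ?l0 ?l1 /=; ring.
Qed.

Lemma Psi_funE k g : Psi_fun k g = (g : 'M[K]_2) ^+ k *+ 2 - (\tr ((g : 'M[K]_2) ^+ k))%:M.
Proof.
have detgk : \det ((g : 'M[K]_2) ^+ k) = 1.
  by elim: k => [|k IH]; rewrite ?expr0 ?det1 // exprS det_mulmx IH SL2_det mulr1.
have invgk : (g : 'M[K]_2) ^- k = (\tr ((g : 'M[K]_2) ^+ k))%:M - (g : 'M[K]_2) ^+ k.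
  by rewrite -adj2 -[LHS]/(invmx _) /invmx unitmxE detgk unitr1 invr1 scale1r.
by rewrite /Psi_fun invgk opprB addrA mulr2n.
Qed.

Fact Psi_tr k g : \tr (Psi_fun k g) = 0.
Proof. by rewrite Psi_funE raddfB raddfMn /= mxtrace_scalar subrr. Qed.

Fact Psi_regular k i j : (fun g => Psi_fun k g i j) \in @regular_fun K.
Proof.
have rX i1 j1 : (fun g : SL2 K => ((g : 'M[K]_2) ^+ k) i1 j1) \in @regular_fun K.
  elim: k i1 j1 => [|k IH] i1 j1.
    rewrite (_ : (fun g => _) = fun _ => (1 : 'M[K]_2) i1 j1) ?regular_cst //.
  rewrite (_ : (fun g => _) = \sum_l (fun g : SL2 K => g i1 l) *
     (fun g : SL2 K => ((g : 'M[K]_2) ^+ k) l j1)).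
    by apply: rpred_sum => l _; apply: rpredM; [exact: regular_entry|exact: IH].
  by apply/funext => g; rewrite exprS mxE fct_sumE; exact: eq_bigr.
rewrite (_ : (fun g => _) = (fun g : SL2 K => ((g : 'M[K]_2) ^+ k) i j) *+ 2 -
   (\sum_l (fun g : SL2 K => ((g : 'M[K]_2) ^+ k) l l)) *+ (i == j)).
  by apply: rpredB; apply: rpredMn => //; apply: rpred_sum => l _.
apply/funext => g; rewrite Psi_funE !mxE mulr2n.
by rewrite fct_sumE; case: (i == j).
Qed.

Fact Psi_conj k h g : Psi_fun k (SL2_conj h g) = h *m Psi_fun k g *m invmx h.
Proof.
have cX : (SL2_conj h g : 'M[K]_2) ^+ k = h *m (g : 'M[K]_2) ^+ k *m invmx h.
  elim: k => [|k IH]; first by rewrite !expr0 mulmx1 mulmxV ?SL2_unit.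
  rewrite !exprS IH -[LHS]/(_ *m _) /= !mulmxA mulmxKV ?SL2_unit //.
rewrite !Psi_funE cX mxtrace_mulC mulmxA mulVmx ?SL2_unit // mul1mx.
rewrite mulmxBr mulmxBl !mulr2n mulmxDr mulmxDl; congr (_ - _).
by rewrite scalar_mxC -mulmxA mulmxV ?SL2_unit // mulmx1.
Qed.

Definition Psi (k : nat) : equivMap K :=
  MkEquivMap (Psi_tr k) (Psi_regular k) (Psi_conj k).

End Psi.

(* Algebraic basis (finite linear combinations); since the index set is nat, the
   initial segments 'I_n suffice to express all finite subfamilies. *)
Definition is_basis (K : pzRingType) (V : lmodType K) (b : nat -> V) : Prop :=
  (forall n (c : 'I_n -> K), \sum_i c i *: b i = 0 -> forall i, c i = 0) /\
  (forall v, exists n (c : 'I_n -> K), v = \sum_i c i *: b i).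

(* Main.v *)
(* An invariant derivation D is the vector field of the equivariant map
   Phi(g) = g^-1 (D x_ij)(g), which is traceless because D(det) = 0.
   Equivariance under the torus and the Weyl element forces
   Phi(diag(a, 1/a)) = diag(f(a), -f(a)) for a Laurent polynomial f with
   f(1/a) = -f(a), i.e. a combination of the a^k - a^-k = Psi_k(diag(a, 1/a))_00.
   Matrices with an eigenbasis are dense, so Phi is determined by its values on
   the torus; density is obtained from the lines g(1 + tN), N nilpotent, which
   stay inside SL2. *)
Require Import Defs.
From mathcomp Require Import all_boot all_order all_algebra.
From mathcomp Require Import all_classical all_reals all_analysis.
From mathcomp Require Import complex.
From mathcomp Require Import ring.
From mathcomp Require mpoly.
Import -(notations) mpoly.

Set Implicit Arguments.
Unset Strict Implicit.
Unset Printing Implicit Defensive.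

Import Order.TTheory GRing.Theory Num.Theory.

Local Open Scope ring_scope.

(** * Two-by-two matrices entry by entry *)

Section Matrix2.
Variable K : comNzRingType.
Implicit Types A B : 'M[K]_2.

Definition mx2 (a b c d : K) : 'M[K]_2 :=
  \matrix_(i, j) if i == 0 then (if j == 0 then a else b)
                 else (if j == 0 then c else d).

Lemma ord2P (i : 'I_2) : i = 0 \/ i = 1.
Proof. by case: i => [[|[|//]] hi]; [left|right]; exact: val_inj. Qed.

Lemma matrix2P A B : A 0 0 = B 0 0 -> A 0 1 = B 0 1 -> A 1 0 = B 1 0 ->
  A 1 1 = B 1 1 -> A = B.
Proof.
by move=> *; apply/matrixP => i j; case: (ord2P i) => ->; case: (ord2P j) => ->.
Qed.

Lemma mulmx2E A B i j : (A *m B) i j = A i 0 * B 0 j + A i 1 * B 1 j.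
Proof.
rewrite mxE !big_ord_recl big_ord0 addr0.
by congr (A _ _ * B _ _ + A _ _ * B _ _); exact: val_inj.
Qed.

End Matrix2.

(** * Polynomials along lines and Laurent functions along the torus *)

Section Poly.
Variable K : numFieldType.
Implicit Types r s : {poly K}.

(** In characteristic 0 the numbers 0, ..., [size r] - 1 are distinct, which is one root too many
    for a nonzero [r]. *)
Lemma poly_eq0_horner r : (forall t, r.[t] = 0) -> r = 0.
Proof.
move=> r0; apply/eqP; apply: contraT => rN0.
have := @max_poly_roots _ r (map (fun n => n%:R) (iota 0 (size r))) rN0.
rewrite size_map size_iota ltnn; apply.
  by apply/allP => t _; apply/eqP.
rewrite map_inj_uniq ?iota_uniq // => m n /eqP.
by rewrite eqr_nat => /eqP.
Qed.

Lemma poly_eq0_generic r s : s != 0 ->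
  (forall t, s.[t] != 0 -> r.[t] = 0) -> r = 0.
Proof.
move=> sN0 r0; have /eqP : r * s = 0.
  apply: poly_eq0_horner => t; rewrite hornerM.
  by have [->|/r0->] := eqVneq s.[t] 0; rewrite ?mulr0 ?mul0r.
by rewrite mulf_eq0 (negbTE sN0) orbF => /eqP.
Qed.

Lemma mxeval_line (p : mpoly (2 * 2) K) (A B : 'M[K]_2) :
  exists r : {poly K}, forall t, r.[t] = mxeval p (A + t *: B).
Proof.
exists (\sum_(m <- msupp p) (mcoeff m p)%:P *
  \prod_i ((mxvec A 0 i)%:P + mxvec B 0 i *: 'X) ^+ m i) => t.
rewrite /mxeval mevalE horner_sum; apply: eq_bigr => m _.
rewrite hornerM hornerC horner_prod; congr (_ * _); apply: eq_bigr => i _.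
rewrite horner_exp hornerD hornerC hornerZ hornerX.
by rewrite [mxvec (A + _)]raddfD /= [mxvec (t *: B)]linearZ /= !mxE [_ * t]mulrC.
Qed.

Lemma regular_fun_line (f : SL2 K -> K) (A B : 'M[K]_2) :
  f \in @regular_fun K ->
  exists r : {poly K}, forall t (g : SL2 K), g = A + t *: B :> 'M[K]_2 -> r.[t] = f g.
Proof.
move=> /regularP[p pE]; have [r rE] := mxeval_line p A B.
by exists r => t g gE; rewrite rE pE gE.
Qed.

(** Laurent polynomials seen as functions on nonzero scalars, with the denominator cleared by a
    power of [a]; the value of [F] at 0 is left free. *)
Definition Laurent (F : K -> K) :=
  exists n (r : {poly K}), forall a, a != 0 -> a ^+ n * F a = r.[a].

Lemma Laurent_cst c : Laurent (fun=> c).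
Proof. by exists 0%N, c%:P => a _; rewrite hornerC mul1r. Qed.

Lemma LaurentD F G : Laurent F -> Laurent G -> Laurent (fun a => F a + G a).
Proof.
move=> [m [r rE]] [n [s sE]]; exists (m + n)%N, ('X^n * r + 'X^m * s) => a a0.
rewrite hornerD !hornerM !hornerXn -rE // -sE // exprD; ring.
Qed.

Lemma LaurentM F G : Laurent F -> Laurent G -> Laurent (fun a => F a * G a).
Proof.
move=> [m [r rE]] [n [s sE]]; exists (m + n)%N, (r * s) => a a0.
rewrite hornerM -rE // -sE // exprD; ring.
Qed.

Lemma Laurent_sum I (l : seq I) (F : I -> K -> K) :
  (forall i, Laurent (F i)) -> Laurent (fun a => \sum_(i <- l) F i a).
Proof.
move=> LF; elim: l => [|i l IH].
  have [n [r rE]] := Laurent_cst 0.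
  by exists n, r => a a0; rewrite big_nil rE.
have [n [r rE]] := LaurentD (LF i) IH.
by exists n, r => a a0; rewrite big_cons rE.
Qed.

Lemma Laurent_prod I (l : seq I) (F : I -> K -> K) :
  (forall i, Laurent (F i)) -> Laurent (fun a => \prod_(i <- l) F i a).
Proof.
move=> LF; elim: l => [|i l IH].
  have [n [r rE]] := Laurent_cst 1.
  by exists n, r => a a0; rewrite big_nil rE.
have [n [r rE]] := LaurentM (LF i) IH.
by exists n, r => a a0; rewrite big_cons rE.
Qed.

Lemma Laurent_exp F n : Laurent F -> Laurent (fun a => F a ^+ n).
Proof.
move=> LF; elim: n => [|n IH]; first exact: Laurent_cst.
have [m [r rE]] := LaurentM LF IH.
by exists m, r => a a0; rewrite exprS rE.
Qed.

Lemma Laurent_mxeval (p : mpoly (2 * 2) K) :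
  Laurent (fun a => mxeval p (mx2 a 0 0 a^-1)).
Proof.
(* Evaluation is by conversion this sum over monomials, so closure under sums, products and powers
   reduces the claim to the four entries. *)
suff : Laurent (fun a => \sum_(m <- msupp p) mcoeff m p *
    \prod_i mxvec (mx2 a 0 0 a^-1) 0 i ^+ m i) by [].
apply: Laurent_sum => m; apply: LaurentM; first exact: Laurent_cst.
apply: Laurent_prod => i; apply: Laurent_exp.
case/mxvec_indexP: i => i j.
have [n [r rE]] : Laurent (fun a => mx2 a 0 0 a^-1 i j).
  case: (ord2P i) => ->; case: (ord2P j) => ->.
  - by exists 0%N, 'X => a _; rewrite hornerX mul1r !mxE.
  - by exists 0%N, 0 => a _; rewrite horner0 mul1r !mxE.
  - by exists 0%N, 0 => a _; rewrite horner0 mul1r !mxE.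
  - by exists 1%N, 1 => a a0; rewrite hornerC !mxE /= divff.
by exists n, r => a a0; rewrite mxvecE rE.
Qed.

(** The functions a^-m and -a^m have the same antisymmetrization under inversion of [a], so each
    negative power can be traded for minus a positive one. *)
Lemma Laurent_antisym F : Laurent F ->
  exists r : {poly K}, forall a, a != 0 -> F a - F a^-1 = r.[a] - r.[a^-1].
Proof.
move=> [n [s sE]].
exists (\sum_(i < size s) s`_i *:
  (if (n <= i)%N then 'X^(i - n) else - 'X^(n - i))) => a a0.
have sE' b : b != 0 -> F b = \sum_(i < size s) s`_i * (b ^+ i / b ^+ n).
  move=> b0; rewrite -[F b](@mulKf _ (b ^+ n)) ?expf_neq0 // sE // horner_coef mulr_sumr.
  by apply: eq_bigr => i _; rewrite mulrC mulrA.
rewrite !sE' ?invr_eq0 // !horner_sum -!sumrB; apply: eq_bigr => i _.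
rewrite !hornerZ -!mulrBr; congr (_ * _).
have ai k : a ^+ k != 0 by exact: expf_neq0.
case: leqP => ni; rewrite ?hornerN !hornerXn !exprVn invrK.
  have -> : a ^+ i = a ^+ (i - n) * a ^+ n by rewrite -exprD subnK.
  by field; rewrite !ai.
have -> : a ^+ n = a ^+ (n - i) * a ^+ i by rewrite -exprD subnK // ltnW.
by field; rewrite !ai.
Qed.

End Poly.

(** * Density of matrices with distinct eigenvalues, and equivariant maps on the torus *)

Section Density.
Variable K : numFieldType.

Lemma regular_fun_eq0 (f : SL2 K -> K) : f \in @regular_fun K ->
  (forall g : SL2 K, g 0 1 != 0 -> \tr g ^+ 2 != 4 -> f g = 0) -> forall g, f g = 0.
Proof.
move=> freg f0.
(* On the line g(1 + tN) the function [f] is polynomial in [t]. If it vanishes wherever a nonzero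
   polynomial [s] does not, it vanishes identically, in particular at t = 0. *)
have line (g : SL2 K) (N : 'M[K]_2) (s : {poly K}) : \tr N = 0 -> \det N = 0 ->
    s != 0 ->
    (forall t (h : SL2 K),
       (forall i j, h i j = g i j + t * (g i 0 * N 0 j + g i 1 * N 1 j)) ->
       s.[t] != 0 -> f h = 0) -> f g = 0.
  move=> trN detN sN0 H.
  (* The determinant of 1 + tN is 1 + t tr N + t^2 det N. *)
  have gN t : \det ((g : 'M[K]_2) + t *: ((g : 'M[K]_2) *m N)) == 1.
    rewrite scalemxAr -[X in \det (X + _)]mulmx1 -mulmxDr det_mulmx SL2_det mul1r.
    move: trN detN; rewrite mxtrace2 !det2 !mxE /= => trN detN.
    apply/eqP; transitivity (1 + t * (N 0 0 + N 1 1) +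
      t ^+ 2 * (N 0 0 * N 1 1 - N 0 1 * N 1 0)); first by ring.
    by rewrite trN detN !mulr0 !addr0.
  have [r rE] := regular_fun_line g (g *m N) freg.
  have r0 : r = 0.
    apply: (poly_eq0_generic sN0) => t st.
    by rewrite (rE t (MkSL2 (gN t))) //; apply: (H t) => // i j; rewrite !mxE -mulmx2E mxE.
  by rewrite -(rE 0) ?r0 ?horner0 // scale0r addr0.
(* Moving along [delta_mx 1 0] keeps the entry (0, 1) and changes the trace to tr g + t g01, which
   is not constant in [t]. *)
have f0' (g : SL2 K) : g 0 1 != 0 -> f g = 0.
  move=> g01.
  apply: (line g (delta_mx 1 0) (((\tr g)%:P + g 0 1 *: 'X) ^+ 2 - 4%:P)).
  - by rewrite mxtrace2 !mxE /= addr0.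
  - by rewrite det2 !mxE /= !(mul0r, mulr0) subrr.
  (* At the parameter where the trace vanishes, the polynomial takes the value -4. *)
  - apply/eqP => /(congr1 (fun s => s.[- \tr g / g 0 1])).
    rewrite hornerD horner_exp hornerD hornerZ hornerN !hornerC hornerX ?horner0.
    rewrite mulrC divfK // subrr expr0n sub0r => /eqP.
    by rewrite oppr_eq0 pnatr_eq0.
  move=> t h hE; rewrite hornerD horner_exp hornerD hornerZ hornerN !hornerC hornerX.
  rewrite subr_eq0 => ht; apply: f0.
    by rewrite hE !mxE /= !mulr0 !addr0 mulr0 addr0.
  rewrite mxtrace2 !hE !mxE /=.
  by rewrite (_ : _ + _ = \tr g + g 0 1 * t) // mxtrace2; ring.
(* If g01 = 0, the determinant forces g00 to be nonzero, and moving along [delta_mx 0 1] makes the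
   entry (0, 1) equal to t g00. *)
move=> g; have [g01|] := eqVneq (g 0 1) 0; last exact: f0'.
have g00 : g 0 0 != 0.
  have := SL2_det g; rewrite det2 g01 mul0r subr0 => /eqP.
  by apply: contraTneq => ->; rewrite mul0r eq_sym oner_neq0.
apply: (line g (delta_mx 0 1) (g 0 0 *: 'X)).
- by rewrite mxtrace2 !mxE /= addr0.
- by rewrite det2 !mxE /= !(mul0r, mulr0) subrr.
- by rewrite scaler_eq0 polyX_eq0 orbF.
move=> t h hE; rewrite hornerZ hornerX => ht; apply: f0'.
by rewrite hE !mxE /= g01 mulr0 mulr1 addr0 add0r mulrC.
Qed.

(** Equivariance in a form free of inverses, so that both sides can be compared entry by entry. *)
Lemma equiv_map_intertwine (Phi : equivMap K) (h g g' : SL2 K) :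
  (g' : 'M[K]_2) *m h = (h : 'M[K]_2) *m g -> Phi g' *m h = (h : 'M[K]_2) *m Phi g.
Proof.
move=> gh; have -> : g' = SL2_conj h g.
  by apply: val_inj; rewrite /= -gh mulmxK ?SL2_unit.
by rewrite equiv_map_conj mulmxKV ?SL2_unit.
Qed.

Fact SL2_mx2_subproof (a b c d : K) : a * d - b * c = 1 -> \det (mx2 a b c d) == 1.
Proof. by move=> e; apply/eqP; rewrite det2 !mxE. Qed.

Definition SL2_mx2 (a b c d : K) e : SL2 K := MkSL2 (@SL2_mx2_subproof a b c d e).

Fact torus_subproof (a : K) : a != 0 -> a * a^-1 - 0 * 0 = 1.
Proof. by move=> a0; rewrite divff // mul0r subr0. Qed.

Definition torus (a : K) (a0 : a != 0) : SL2 K := SL2_mx2 (torus_subproof a0).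

Lemma torusX (a : K) (a0 : a != 0) k :
  (torus a0 : 'M[K]_2) ^+ k = mx2 (a ^+ k) 0 0 (a ^- k).
Proof.
elim: k => [|k IH].
  by apply: matrix2P; rewrite !mxE //= invr1.
rewrite exprS IH -[LHS]/(_ *m _); apply: matrix2P; rewrite mulmx2E !mxE /=.
- by rewrite mulr0 addr0 exprS.
- by rewrite mulr0 mul0r addr0.
- by rewrite mulr0 mul0r addr0.
- by rewrite mulr0 add0r exprS invfM.
Qed.

Lemma Psi_torus k (a : K) (a0 : a != 0) :
  Psi K k (torus a0) 0 0 = a ^+ k - a ^- k.
Proof. by rewrite /= Psi_funE torusX mulr2n !mxE mxtrace2 !mxE /=; ring. Qed.

(* Conjugation by diag(2, 1/2) scales the off-diagonal entries by 4 and 1/4. *)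
Lemma equiv_map_torus (Phi : equivMap K) (a : K) (a0 : a != 0) :
  Phi (torus a0) = mx2 (Phi (torus a0) 0 0) 0 0 (- Phi (torus a0) 0 0).
Proof.
have n20 : (2 : K) != 0 by rewrite pnatr_eq0.
set X := Phi _.
have comm : X *m torus n20 = torus n20 *m X.
  apply: equiv_map_intertwine; apply: matrix2P; rewrite !mulmx2E !mxE /=; ring.
have three : (2 * 2 - 1 : K) != 0.
  by rewrite (_ : _ - 1 = 3) ?pnatr_eq0 //; ring.
apply: matrix2P; rewrite [RHS]mxE //=.
- have /eqP := congr1 (fun A : 'M[K]_2 => A 0 1) comm.
  rewrite !mulmx2E !mxE /= mulr0 add0r mul0r addr0 -subr_eq0.
  rewrite (_ : _ - _ = - ((2 * 2 - 1) / 2 * X 0 1)); last by field.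
  by rewrite oppr_eq0 !mulf_eq0 invr_eq0 (negbTE three) (negbTE n20) => /eqP.
- have /eqP := congr1 (fun A : 'M[K]_2 => A 1 0) comm.
  rewrite !mulmx2E !mxE /= mulr0 addr0 mul0r add0r -subr_eq0.
  rewrite (_ : _ - _ = (2 * 2 - 1) / 2 * X 1 0); last by field.
  by rewrite !mulf_eq0 invr_eq0 (negbTE three) (negbTE n20) => /eqP.
- by apply/eqP; rewrite -addr_eq0 addrC -mxtrace2 equiv_map_tr.
Qed.

(** The Weyl element with rows (0, 1) and (-1, 0) swaps the two diagonal entries, and these are
    opposite in the image of a torus element. *)
Lemma equiv_map_weyl (Phi : equivMap K) (a : K) (a0 : a != 0) (a0' : a^-1 != 0) :
  Phi (torus a0') 0 0 = - Phi (torus a0) 0 0.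
Proof.
have e : (0 : K) * 0 - 1 * (-1) = 1 by ring.
have /(congr1 (fun A : 'M[K]_2 => A 0 1)) :
    Phi (torus a0') *m SL2_mx2 e = SL2_mx2 e *m Phi (torus a0).
  by apply: equiv_map_intertwine; apply: matrix2P; rewrite !mulmx2E !mxE /= ?invrK; ring.
by rewrite (equiv_map_torus Phi a0) !mulmx2E !mxE /= mulr0 mulr1 addr0 mul0r add0r mul1r.
Qed.

End Density.

(** * Diagonalization in SL2 over an algebraically closed field *)

Section Diagonalization.
Variable C : numClosedFieldType.

Lemma SL2_diagonalizable (g : SL2 C) : g 0 1 != 0 -> \tr g ^+ 2 != 4 ->
  exists (a : C) (a0 : a != 0) (h : SL2 C),
    (g : 'M[C]_2) *m h = (h : 'M[C]_2) *m torus a0.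
Proof.
move=> g01 trg; have := SL2_det g; rewrite det2.
set x := g 0 0; set y := g 0 1 in g01 *; set z := g 1 0; set w := g 1 1 => detg.
(* The characteristic polynomial has discriminant (tr g)^2 - 4; its roots [a] and [b] are distinct
   since [d] is nonzero, and their product is det g = 1. *)
pose d := sqrtC ((x + w) ^+ 2 - 4).
have d2 : d ^+ 2 = (x + w) ^+ 2 - 4 by exact: sqrtCK.
have d0 : d != 0 by rewrite sqrtC_eq0 subr_eq0 -mxtrace2.
have n20 : (2 : C) != 0 by rewrite pnatr_eq0.
pose a := (x + w + d) / 2; pose b := (x + w - d) / 2.
have ab : a * b = 1.
  transitivity (((x + w) ^+ 2 - d ^+ 2) / 4); first by rewrite /a /b; field.
  by rewrite d2; field.
have a0 : a != 0 by apply: contra_eq_neq ab => ->; rewrite mul0r eq_sym oner_neq0.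
have aV : a^-1 = b by rewrite -[b](mulKf a0) ab mulr1.
have apb : a + b = x + w by rewrite /a /b; field.
(* The columns of h are the eigenvectors (y, a - x) and (y, b - x), the second
   one divided by y (b - a) = - y d so that det h = 1. *)
have deth : y * ((b - x) / (- (y * d))) - (y / (- (y * d))) * (a - x) = 1.
  by rewrite /a /b; field; rewrite d0 g01.
exists a, a0, (SL2_mx2 deth).
(* Second coordinate of the eigenvector equation for (y, a - x); it follows from xw - yz = ab and a
   + b = x + w. *)
have ax : z * y + w * (a - x) = a * (a - x).
  transitivity (w * a - (x * w - y * z)); first by ring.
  by rewrite detg -ab (_ : w = a + b - x); [ring | rewrite apb; ring].
have bx : z * y + w * (b - x) = b * (b - x).
  transitivity (w * b - (x * w - y * z)); first by ring.
  by rewrite detg -ab (_ : w = a + b - x); [ring | rewrite apb; ring].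
apply: matrix2P; rewrite !mulmx2E !mxE /= ?aV -/x -/y -/z -/w.
- by ring.
- by ring.
- by rewrite ax; ring.
- transitivity ((z * y + w * (b - x)) / - (y * d)); first by ring.
  by rewrite bx; ring.
Qed.

(** Equivariance carries agreement from the torus to all diagonalizable matrices; the entries of the
    difference are regular, so density finishes. *)
Lemma equiv_map_ext (Phi1 Phi2 : equivMap C) :
  (forall a (a0 : a != 0), Phi1 (torus a0) 0 0 = Phi2 (torus a0) 0 0) ->
  forall g, Phi1 g = Phi2 g.
Proof.
move=> eqT g; apply/matrixP => i j; apply/eqP; rewrite -subr_eq0; apply/eqP.
pose f (g : SL2 C) := Phi1 g i j - Phi2 g i j.
apply: (@regular_fun_eq0 _ f); first by apply: rpredB; exact: equiv_map_regular.
move=> {}g g01 trg; have [a [a0 [h gh]]] := SL2_diagonalizable g01 trg.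
rewrite /f; have -> : Phi1 g = Phi2 g; last by rewrite subrr.
have := equiv_map_intertwine Phi1 gh; have := equiv_map_intertwine Phi2 gh.
rewrite (equiv_map_torus Phi1) (equiv_map_torus Phi2) eqT => <- /(congr1 (mulmx^~ (invmx h))).
by rewrite !mulmxK ?SL2_unit.
Qed.

End Diagonalization.

(** * Linear combinations of equivariant maps and of their vector fields *)

Section LinearCombination.
Variable K : numFieldType.
Variables (n : nat) (c : 'I_n -> K) (Phi : 'I_n -> equivMap K).

Definition equiv_lincomb_fun (g : SL2 K) : 'M[K]_2 := \sum_i c i *: Phi i g.

Fact equiv_lincomb_tr g : \tr (equiv_lincomb_fun g) = 0.
Proof.
by rewrite raddf_sum big1 // => i _; rewrite /= linearZ /= equiv_map_tr mulr0.
Qed.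

Fact equiv_lincomb_regular i j :
  (fun g => equiv_lincomb_fun g i j) \in @regular_fun K.
Proof.
rewrite (_ : (fun g => _) = \sum_k (fun=> c k) * (fun g => Phi k g i j)).
  apply: rpred_sum => k _; apply: rpredM; first exact: regular_cst.
  exact: equiv_map_regular.
apply/funext => g; rewrite /equiv_lincomb_fun summxE fct_sumE.
by apply: eq_bigr => k _; rewrite mxE.
Qed.

Fact equiv_lincomb_conj h g :
  equiv_lincomb_fun (SL2_conj h g) = h *m equiv_lincomb_fun g *m invmx h.
Proof.
rewrite /equiv_lincomb_fun mulmx_sumr mulmx_suml; apply: eq_bigr => k _.
by rewrite equiv_map_conj -scalemxAr -scalemxAl.
Qed.

Definition equiv_lincomb : equivMap K :=
  MkEquivMap equiv_lincomb_tr equiv_lincomb_regular equiv_lincomb_conj.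

Lemma vfieldE (E : equivMap K) f g :
  vfield E f g = dmx (extension f) g ((g : 'M[K]_2) *m E g).
Proof. exact: flow_derivativeE. Qed.

Lemma X2_lincombE (D : 'I_n -> X2 K) f g :
  (\sum_i c i *: D i) f g = \sum_i c i * D i f g.
Proof.
by elim/big_rec2: _ => [//|i x y _ <-].
Qed.

(** The differential [dmx] is linear in its direction. *)
Lemma vfield_lincomb : vfield equiv_lincomb = \sum_i c i *: vfield (Phi i).
Proof.
apply: val_inj; apply/funext => f; apply: coordRing_ext => g.
rewrite [RHS]X2_lincombE [LHS]vfieldE [equiv_map _ _]/(equiv_lincomb_fun g) mulmx_sumr.
elim/big_rec2: _ => [|i x y _ <-].
  by rewrite /dmx big1 // => k _; rewrite linear0 mxE mulr0.
by rewrite dmxD -scalemxAr dmxZ vfieldE.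
Qed.

End LinearCombination.

(** * Spanning by the maps Psi *)

Section Span.
Variable C : numClosedFieldType.

Lemma equiv_map_lincomb_Psi (Phi : equivMap C) : exists n (c : 'I_n -> C),
  forall g, Phi g = equiv_lincomb c (fun i : 'I_n => Psi C i.+1) g.
Proof.
have [p pE] := regularP _ (equiv_map_regular Phi 0 0).
have [r rE] := Laurent_antisym (Laurent_mxeval p).
(* With f the (0, 0) entry on the torus, 2f(a) = f(a) - f(1/a) = r(a) - r(1/a). This explains the
   division by 2; the constant coefficient of [r] cancels, hence the index shift. *)
exists (size r).-1, (fun i => r`_i.+1 / 2); apply: equiv_map_ext => a a0.
have n20 : (2 : C) != 0 by rewrite pnatr_eq0.
have a0' : a^-1 != 0 by rewrite invr_eq0.
apply: (mulIf n20); transitivity (r.[a] - r.[a^-1]).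
  rewrite -rE // -[mx2 a _ _ _]/(SL2_val (torus a0)) -pE.
  rewrite -[mx2 a^-1 _ _ _]/(SL2_val (torus a0')) -pE equiv_map_weyl opprK.
  by rewrite mulr_natr mulr2n.
rewrite /= /equiv_lincomb_fun summxE mulr_suml !horner_coef -sumrB.
under [RHS]eq_bigr do rewrite mxE Psi_torus.
case: (size r) => [|m]; first by rewrite !big_ord0.
rewrite big_ord_recl !expr0 subrr add0r; apply: eq_bigr => i _ /=.
by rewrite -[bump 0 i]/(i.+1) exprVn -mulrBr mulrAC divfK.
Qed.

End Span.

(** * Coordinate functions on SL2 *)

Section Coordinates.
Variable K : numFieldType.

Definition mxcoord (p : mpoly (2 * 2) K) : coordRing K :=
  @MkCoordRing K (fun g => mxeval p g)
    (introT (regularP _) (ex_intro _ p (fun g => erefl))).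

Definition entry (i j : 'I_2) : coordRing K := MkCoordRing (regular_entry K i j).

Lemma coordRing_addE (f1 f2 : coordRing K) g : (f1 + f2) g = f1 g + f2 g.
Proof. by []. Qed.

Lemma coordRing_mulE (f1 f2 : coordRing K) g : (f1 * f2) g = f1 g * f2 g.
Proof. by []. Qed.

Lemma coordRing_scaleE c (f : coordRing K) g : (c *: f) g = c * f g.
Proof. by []. Qed.

Lemma coordRing_sumE I (l : seq I) (F : I -> coordRing K) g :
  (\sum_(i <- l) F i) g = \sum_(i <- l) F i g.
Proof. by elim/big_rec2: _ => [//|i x y _ <-]. Qed.

Lemma mxcoord_extension (f : coordRing K) : mxcoord (extension f) = f.
Proof. by apply: coordRing_ext => g; rewrite [RHS]extensionP. Qed.

Lemma dmx_coord i j (A U : 'M[K]_2) : dmx (mpolyX _ (mnm1 (mxvec_index i j))) A U = U i j.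
Proof.
set k := mxvec_index i j; rewrite /dmx (bigD1 k) //= big1 ?addr0 => [|l lk].
  have mm0 : mnm_sub (mnm1 k) (mnm1 k) = @mnm0 (2 * 2).
    by rewrite -[X in mnm_sub X _]add0m addmK.
  by rewrite mderivX mnmE eqxx mm0 mpolyX0 /mxeval mevalZ meval1 mulr1 mul1r mxvecE.
by rewrite mderivX mnm1E eq_sym (negbTE lk) scale0r /mxeval meval0 mul0r.
Qed.

(** The field does not depend on the chosen extension, so the coordinate monomial may replace it. *)
Lemma vfield_entry (Phi : equivMap K) i j g :
  vfield Phi (entry i j) g = ((g : 'M[K]_2) *m Phi g) i j.
Proof.
rewrite -(dmx_coord i j g) -flow_derivativeE; apply: vfield_extension => h.
by rewrite /mxeval mevalXU mxvecE.
Qed.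

End Coordinates.

(** * From an invariant derivation to an equivariant map *)

Section Derivation.
Variables (K : numFieldType) (D : X2 K).

Let D_linear c f1 f2 : D (c *: f1 + f2) = c *: D f1 + D f2.
Proof. by have /invariant_vfieldP[[lin _] _] := X2_funP D; exact: lin. Qed.

Let D_mul f1 f2 : D (f1 * f2) = D f1 * f2 + f1 * D f2.
Proof. by have /invariant_vfieldP[[_ der] _] := X2_funP D; exact: der. Qed.

Let D_add f1 f2 : D (f1 + f2) = D f1 + D f2.
Proof. by rewrite -[f1]scale1r D_linear !scale1r. Qed.

Let D_0 : D 0 = 0.
Proof. by apply: (addIr (D 0)); rewrite -D_add !add0r. Qed.

Let D_scale c f : D (c *: f) = c *: D f.
Proof. by rewrite -[c *: f]addr0 D_linear D_0 addr0. Qed.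

Let D_sum I (l : seq I) (F : I -> coordRing K) :
  D (\sum_(i <- l) F i) = \sum_(i <- l) D (F i).
Proof. exact: (big_morph _ D_add D_0). Qed.

Let D_1 : D 1 = 0.
Proof.
have := D_mul 1 1; rewrite !(mulr1, mul1r) => e.
by apply: (addIr (D 1)); rewrite add0r -e.
Qed.

Definition X2_mx (g : SL2 K) : 'M[K]_2 := \matrix_(i, j) D (entry K i j) g.

(** As functions of a polynomial, both sides are derivations over evaluation at [g]; they agree on
    constants and variables, hence on all polynomials. *)
Lemma X2_dmx (f : coordRing K) g : D f g = dmx (extension f) g (X2_mx g).
Proof.
rewrite -{1}(mxcoord_extension f); move: (extension f) => p.
pose Q (q : mpoly (2 * 2) K) := D (mxcoord q) g = dmx q g (X2_mx g).
have QM q1 q2 : Q q1 -> Q q2 -> Q (q1 * q2).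
  rewrite /Q => d1 d2.
  rewrite (_ : mxcoord (q1 * q2) = mxcoord q1 * mxcoord q2); last first.
    by apply: coordRing_ext => h; rewrite /= /mxeval mevalM.
  rewrite D_mul coordRing_addE !coordRing_mulE d1 d2 /dmx /= mulr_suml mulr_sumr -big_split.
  by apply: eq_bigr => k _; rewrite /= mderivM /mxeval mevalD !mevalM; ring.
have QC c : Q (mpolyC _ c).
  rewrite /Q (_ : mxcoord _ = c *: (1 : coordRing K)); last first.
    by apply: coordRing_ext => h; rewrite /= /mxeval mevalC -[RHS]/(c * 1) mulr1.
  rewrite D_scale D_1 scaler0 /dmx big1 // => k _.
  by rewrite mderivC /mxeval meval0 mul0r.
have QX k : Q (mpolyX _ (mnm1 k)).
  case/mxvec_indexP: k => i j;   rewrite /Q (_ : mxcoord _ = entry K i j); last first.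
    by apply: coordRing_ext => h; rewrite /= /mxeval mevalXU mxvecE.
  by rewrite dmx_coord mxE.
have QD q1 q2 : Q q1 -> Q q2 -> Q (q1 + q2).
  rewrite /Q => d1 d2.
  rewrite (_ : mxcoord (q1 + q2) = mxcoord q1 + mxcoord q2); last first.
    by apply: coordRing_ext => h; rewrite /= /mxeval mevalD.
  rewrite D_add coordRing_addE d1 d2 /dmx -big_split.
  by apply: eq_bigr => k _; rewrite /= mderivD /mxeval mevalD mulrDl.
rewrite -/(Q p); elim/mpolyind: p => [|c m p _ _ IH]; first exact: (QC 0).
apply: (QD _ _ _ IH); rewrite -mul_mpolyC; apply: (QM _ _ (QC c)).
rewrite mpolyXE_id; apply: big_ind; [exact: (QC 1)|exact: QM|move=> i _].
by elim: (m i) => [|n IHn]; [exact: (QC 1)|rewrite exprS; exact: (QM _ _ (QX i) IHn)].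
Qed.

Definition X2_map_fun (g : SL2 K) : 'M[K]_2 := invmx g *m X2_mx g.

(** Applying [D] to det = 1 gives tr(adj(g) Dg) = 0, and adj(g) is the inverse of [g]. *)
Fact X2_map_tr g : \tr (X2_map_fun g) = 0.
Proof.
have det1 : entry K 0 0 * entry K 1 1 + (-1) *: (entry K 0 1 * entry K 1 0) = 1.
  apply: coordRing_ext => h; transitivity (\det (h : 'M[K]_2)); last exact: SL2_det.
  by rewrite det2 coordRing_addE coordRing_scaleE !coordRing_mulE mulN1r.
have /(congr1 (fun f : coordRing K => f g)) := congr1 D det1.
rewrite D_add D_scale !D_mul D_1 coordRing_addE coordRing_scaleE.
rewrite !(coordRing_addE, coordRing_mulE) -[RHS]/(0 : K) => <-.
rewrite /X2_map_fun SL2_inv adj2 mxtrace2 !mulmx2E !mxE mxtrace2 /=.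
by ring.
Qed.

Fact X2_map_regular i j : (fun g => X2_map_fun g i j) \in @regular_fun K.
Proof.
(* The inverse of [g] is tr(g) - g, whose entries are visibly regular. *)
rewrite (_ : (fun g => _) = \sum_k
    ((fun g : SL2 K => \tr g) *+ (i == k) - (fun g : SL2 K => g i k)) *
    (D (entry K k j) : SL2 K -> K)).
  apply: rpred_sum => k _; apply: rpredM; last exact: coord_funP.
  apply: rpredB; last exact: regular_entry.
  apply: rpredMn; rewrite (_ : (fun g => _) = \sum_l (fun g : SL2 K => g l l)).
    by apply: rpred_sum => l _; exact: regular_entry.
  by apply/funext => g; rewrite fct_sumE.
apply/funext => g; rewrite /X2_map_fun SL2_inv adj2 mxE fct_sumE.
apply: eq_bigr => k _; rewrite !mxE.
by case: (i == k); rewrite ?mulr1n ?mulr0n.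
Qed.

Lemma X2_mx_conj h g : X2_mx (SL2_conj h g) = h *m X2_mx g *m invmx h.
Proof.
apply/matrixP => i j; rewrite mxE.
have /invariant_vfieldP[_ /(_ h (entry K i j)) e] := X2_funP D.
rewrite -[LHS]/(pullback_conj h (D (entry K i j)) g) -e.
(* A conjugated coordinate is a combination of coordinates with coefficients independent of the
   point, so [D] passes through them by linearity. *)
rewrite (_ : pullback_conj h _ =
    \sum_l \sum_k (h i k * invmx h l j) *: entry K k l); last first.
  apply: coordRing_ext => x.
  rewrite coordRing_sumE /= mxE; apply: eq_bigr => l _.
  rewrite coordRing_sumE mxE mulr_suml; apply: eq_bigr => k _.
  by rewrite coordRing_scaleE /=; ring.
rewrite D_sum coordRing_sumE mxE; apply: eq_bigr => l _.
rewrite D_sum coordRing_sumE mxE mulr_suml; apply: eq_bigr => k _.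
by rewrite D_scale coordRing_scaleE [X2_mx _ _ _]mxE; ring.
Qed.

Fact X2_map_conj h g : X2_map_fun (SL2_conj h g) = h *m X2_map_fun g *m invmx h.
Proof.
apply: (can_inj (mulKmx (SL2_unit (SL2_conj h g)))).
rewrite /X2_map_fun mulKVmx ?SL2_unit // X2_mx_conj /= !mulmxA.
by rewrite mulmxKV ?SL2_unit // mulmxK ?SL2_unit.
Qed.

Definition X2_map : equivMap K :=
  MkEquivMap X2_map_tr X2_map_regular X2_map_conj.

Lemma vfield_X2_map : vfield X2_map = D.
Proof.
apply: val_inj; apply/funext => f; apply: coordRing_ext => g.
by rewrite [LHS]vfieldE [RHS]X2_dmx /= /X2_map_fun mulKVmx ?SL2_unit.
Qed.

End Derivation.

(** * Linear independence *)

Section Independence.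
Variable K : numFieldType.

Lemma Psi_free n (c : 'I_n -> K) :
  (forall a, a != 0 -> \sum_i c i * (a ^+ i.+1 - a ^- i.+1) = 0) ->
  forall i, c i = 0.
Proof.
move=> c0 j.
(* Multiplication by a^n clears denominators; since i < n, the exponent n - (i + 1) is a genuine
   difference. *)
have q0 : \sum_i c i *: ('X^(n + i.+1) - 'X^(n - i.+1)) = 0 :> {poly K}.
  apply: (@poly_eq0_generic _ _ 'X) => [|a]; first by rewrite polyX_eq0.
  rewrite hornerX => a0; rewrite -[RHS](mulr0 (a ^+ n)) -(c0 a a0).
  rewrite horner_sum mulr_sumr; apply: eq_bigr => i _.
  rewrite hornerZ hornerD hornerN !hornerXn exprD.
  have -> : a ^+ n = a ^+ (n - i.+1) * a ^+ i.+1 by rewrite -exprD subnK.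
  by field; rewrite expf_neq0.
have /(congr1 (fun q : {poly K} => q`_(n + j.+1))) := q0.
(* The negative terms have exponents at most n, so only c_j contributes to the coefficient of degree
   n + j + 1. *)
have lt_n m : (n - m < n + j.+1)%N.
  by rewrite (leq_ltn_trans (leq_subr _ _)) // -addSnnS leq_addr.
rewrite coef_sum (bigD1 j) //= big1 => [|i ij]; rewrite coefZ coefB !coefXn (gtn_eqF (lt_n _)).
  by rewrite addr0 coef0 eqxx subr0 mulr1.
by rewrite eqn_add2l eqSS eq_sym (negbTE (ij : i != j :> nat)) subr0 mulr0.
Qed.

End Independence.

Theorem corollary4p1 (R : realType) :
  is_basis (fun k : nat => vfield (Psi R[i] k.+1)).
Proof.
split=> [n c /= c0|D]; last first.
  have [n [c PhiE]] := equiv_map_lincomb_Psi (X2_map D).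
  exists n, c; rewrite -vfield_lincomb -[LHS]vfield_X2_map.
  apply: val_inj; apply/funext => f; apply: coordRing_ext => g.
  by rewrite [LHS]vfieldE [RHS]vfieldE PhiE.
(* The factor [a] comes from evaluating the vanishing field on the coordinate (0, 0) at diag(a,
   1/a), which yields the (0, 0) entry of g Phi(g). *)
apply: Psi_free => a a0; apply: (mulfI a0).
have /(congr1 (fun D : X2 R[i] => D (entry _ 0 0) (torus a0))) := c0.
rewrite /= -vfield_lincomb vfield_entry mulmx2E !mxE /= mul0r addr0 => c0a.
rewrite mulr0 -[RHS]c0a; congr (a * _); rewrite /equiv_lincomb_fun summxE.
by apply: eq_bigr => i _; rewrite mxE Psi_torus.
Qed.
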